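(* For every integer $n\ge 3$, the corank of the Artin pure braid group $P_n$ is equal to $2$.
   Context: The Artin braid group $B_n$ has generators $\sigma_1,\dots,\sigma_{n-1}$ and relations $\sigma_i\sigma_{i+1}\sigma_i=\sigma_{i+1}\sigma_i\sigma_{i+1}$ for $1\le i\le n-2$ and $\sigma_j\sigma_i=\sigma_i\sigma_j$ for $|j-i|\ge 2$. The Artin pure braid group is $P_n=\ker(B_n\to\Sigma_n)$, the kernel of the natural map to the symmetric group $\Sigma_n$ sending $\sigma_i$ to the transposition $(i\ i{+}1)$. The corank of a group $G$ is the largest natural number $k$ for which the free group $F_k$ of rank $k$ is an epimorphic image of $G$. *)

(* Defs.v *)
From HB Require Import structures.
From mathcomp Require Import all_boot fingroup perm.
From mathcomp Require Import boolp generic_quotient.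

Set Implicit Arguments.
Unset Strict Implicit.
Unset Printing Implicit Defensive.

Import GroupScope.
Local Open Scope group_scope.
Local Open Scope quotient_scope.

Notation group_hom G H := (UMagmaMorphism.type G%type H%type).

(* A letter (x, false) stands for the generator x, (x, true) for its inverse. *)
Notation word X := (seq (X * bool)).

Definition gen_word (X : Type) (s : seq X) : word X := [seq (x, false) | x <- s].

Definition inv_word (X : Type) (w : word X) : word X :=
  rev [seq (a.1, ~~ a.2) | a <- w].

(* The least congruence on words that contains R and makes (x, b) and         *)
(* (x, ~~ b) mutually inverse.                                                *)
Inductive word_eq (X : Type) (R : word X -> word X -> Prop) :
    word X -> word X -> Prop :=
  | word_eq_rel u v : R u v -> word_eq R u v
  | word_eq_cancel x b : word_eq R [:: (x, b); (x, ~~ b)] [::]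
  | word_eq_cat u u' v v' :
      word_eq R u u' -> word_eq R v v' -> word_eq R (u ++ v) (u' ++ v')
  | word_eq_refl u : word_eq R u u
  | word_eq_sym u v : word_eq R u v -> word_eq R v u
  | word_eq_trans v u w : word_eq R u v -> word_eq R v w -> word_eq R u w.

Section PresentedGroup.

Variables (X : choiceType) (R : word X -> word X -> Prop).

Definition word_eqb : rel (word X) := fun u v => `[< word_eq R u v >].

Fact word_eqb_equiv : equiv_class_of word_eqb.
Proof.
split=> [u | u v | v u w].
- exact/asboolP/word_eq_refl.
- by apply/asboolP/asboolP; apply: word_eq_sym.
- by move=> /asboolP uv /asboolP vw; apply/asboolP; apply: word_eq_trans vw.
Qed.

Canonical word_eqb_equiv_rel := EquivRelPack word_eqb_equiv.

(* The group < X | u = v for all u, v such that R u v >.                      *)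
Definition presented : Type := {eq_quot word_eqb}.
HB.instance Definition _ := Choice.on presented.
HB.instance Definition _ := EqQuotient.on presented.

Definition class_of (w : word X) : presented := \pi_presented w.

Lemma class_ofP u v : reflect (word_eq R u v) (class_of u == class_of v).
Proof. by rewrite /class_of piE; apply: asboolP. Qed.

Lemma class_of_eq u v : word_eq R u v -> class_of u = class_of v.
Proof. by move=> /class_ofP/eqP. Qed.

Lemma class_of_repr x : class_of (repr x) = x. Proof. exact: reprK. Qed.

Lemma word_eq_repr u : word_eq R (repr (class_of u)) u.
Proof. by apply/class_ofP; rewrite class_of_repr. Qed.

Definition presented_mul (x y : presented) : presented :=
  class_of (repr x ++ repr y).
Definition presented_one : presented := class_of [::].
Definition presented_inv (x : presented) : presented :=
  class_of (inv_word (repr x)).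

Lemma class_of_cat u v :
  class_of (u ++ v) = presented_mul (class_of u) (class_of v).
Proof.
by apply: class_of_eq; apply: word_eq_sym; apply: word_eq_cat; apply: word_eq_repr.
Qed.

Fact presented_mulA : associative presented_mul.
Proof.
move=> x y z; rewrite -(class_of_repr x) -(class_of_repr y) -(class_of_repr z).
by rewrite -!class_of_cat catA.
Qed.

Fact presented_1mul : left_id presented_one presented_mul.
Proof. by move=> x; rewrite -(class_of_repr x) -class_of_cat. Qed.

Fact presented_mul1 : right_id presented_one presented_mul.
Proof. by move=> x; rewrite -(class_of_repr x) -class_of_cat cats0. Qed.

Lemma word_eq_mulV (w : word X) : word_eq R (w ++ inv_word w) [::].
Proof.
elim: w => [|[x b] w IHw]; first exact: word_eq_refl.
rewrite /inv_word /= rev_cons -cats1 catA.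
apply: word_eq_trans (word_eq_cancel R x b).
apply: (@word_eq_cat _ _ [:: (x, b)] [:: (x, b)]); first exact: word_eq_refl.
by apply: (word_eq_cat (u' := [::])) => //; apply: word_eq_refl.
Qed.

Lemma inv_wordK : involutive (@inv_word X).
Proof.
move=> w; rewrite /inv_word map_rev revK -map_comp -[RHS]map_id.
by apply: eq_map => -[x b] /=; rewrite negbK.
Qed.

Fact presented_mulV :
  right_inverse presented_one presented_inv presented_mul.
Proof.
move=> x; rewrite -{1}(class_of_repr x) -class_of_cat.
exact/class_of_eq/word_eq_mulV.
Qed.

Fact presented_Vmul :
  left_inverse presented_one presented_inv presented_mul.
Proof.
move=> x; rewrite -{2}(class_of_repr x) -class_of_cat -{2}(inv_wordK (repr x)).
exact/class_of_eq/word_eq_mulV.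
Qed.

HB.instance Definition _ := isGroup.Build presented
  presented_mulA presented_1mul presented_mul1 presented_Vmul presented_mulV.

Definition presented_gen (x : X) : presented := class_of (gen_word [:: x]).

End PresentedGroup.

Section UniversalProperty.

Variables (X : choiceType) (R : word X -> word X -> Prop) (H : groupType).
Variable f : X -> H.

Definition eval_word (w : word X) : H :=
  \prod_(a <- w) (if a.2 then (f a.1)^-1 else f a.1).

Hypothesis fR : forall u v, R u v -> eval_word u = eval_word v.

Definition presented_lift (_ : forall u v, R u v -> eval_word u = eval_word v)
  (x : presented R) : H := eval_word (repr x).

Lemma eval_word_eq u v : word_eq R u v -> eval_word u = eval_word v.
Proof.
elim=> {u v} [u v /fR // | x [] | u u' v v' _ eu _ ev | // | // | v u w _ -> _ -> //].
- by rewrite /eval_word !big_cons big_nil /= mulg1 mulVg.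
- by rewrite /eval_word !big_cons big_nil /= mulg1 mulgV.
- by rewrite /eval_word !big_cat -/(eval_word _) /=; congr (_ * _).
Qed.

Fact presented_lift_morphism : monoid_morphism (presented_lift fR).
Proof.
split=> [|x y].
  by rewrite /presented_lift (eval_word_eq (word_eq_repr R _)) /eval_word big_nil.
rewrite /presented_lift (eval_word_eq (word_eq_repr R _)).
by rewrite /eval_word big_cat.
Qed.

HB.instance Definition _ := isUMagmaMorphism.Build _ _ (presented_lift fR)
  presented_lift_morphism.

Lemma presented_lift_gen x : presented_lift fR (presented_gen R x) = f x.
Proof.
rewrite /presented_lift (eval_word_eq (word_eq_repr R _)).
by rewrite /eval_word big_cons big_nil /= mulg1.
Qed.

End UniversalProperty.

Definition free_group (k : nat) : groupType :=
  presented (fun _ _ : word 'I_k => False).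

Section Kernel.

Variables (G H : groupType) (f : group_hom G H).

Definition in_kernel : {pred G} := [pred x | f x == 1].

Fact in_kernel_closed : group_closed in_kernel.
Proof.
split=> [|x y]; first by rewrite inE gmulf1.
by rewrite !inE gmulfF => /eqP-> /eqP->; rewrite divg1.
Qed.

Definition kernel : Type := {x : G | x \in in_kernel}.

HB.instance Definition _ := SubChoice.on kernel.
HB.instance Definition _ :=
  SubChoice_isSubGroup.Build G in_kernel kernel in_kernel_closed.

End Kernel.

(* The index i : 'I_n.-1 stands for the generator sigma_(i + 1).              *)
Inductive braid_rel (n : nat) : word 'I_n.-1 -> word 'I_n.-1 -> Prop :=
  | braid_rel_adjacent (i j : 'I_n.-1) : j = i.+1 :> nat ->
      braid_rel (gen_word [:: i; j; i]) (gen_word [:: j; i; j])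
  | braid_rel_far (i j : 'I_n.-1) : (i.+2 <= j) || (j.+2 <= i) ->
      braid_rel (gen_word [:: j; i]) (gen_word [:: i; j]).

Definition braid_group (n : nat) : groupType := presented (@braid_rel n).

Fact braid_index_lt n (i : 'I_n.-1) : i.+1 < n.
Proof. by case: n i => [[]|n i] //; rewrite ltnS. Qed.

Definition adjacent_transposition n (i : 'I_n.-1) : 'S_n :=
  tperm (Ordinal (ltnW (braid_index_lt i))) (Ordinal (braid_index_lt i)).

Fact adjacent_transposition_braid_rel n (u v : word 'I_n.-1) :
  braid_rel u v ->
  eval_word (@adjacent_transposition n) u = eval_word (@adjacent_transposition n) v.
Proof.
case=> i j ij; rewrite /eval_word !big_cons big_nil /= !mulg1.
- set s := adjacent_transposition.
  have -> : s n i * (s n j * s n i) = s n j ^ s n i.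
    by rewrite conjgE /s tpermV.
  have -> : s n j * (s n i * s n j) = s n i ^ s n j.
    by rewrite conjgE /s tpermV.
  rewrite /s /adjacent_transposition !tpermJ.
  set i0 := Ordinal (ltnW (braid_index_lt i)).
  set i1 := Ordinal (braid_index_lt i).
  have -> : Ordinal (ltnW (braid_index_lt j)) = i1 by apply: val_inj.
  set j1 := Ordinal (braid_index_lt j).
  have i0j1 : i0 != j1 by rewrite -val_eqE /= ij neq_ltn ltnS leqnSn.
  have i1j1 : i1 != j1 by rewrite -val_eqE /= ij neq_ltn ltnSn.
  have i0i1 : i0 != i1 by rewrite -val_eqE /= neq_ltn ltnSn.
  by rewrite tpermR tpermL !tpermD // eq_sym.
- rewrite conjgC; congr (_ * _); rewrite tpermJ.
  congr tperm; rewrite tpermD // -val_eqE neq_ltn /=;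
    by case/orP: ij => ij;
      rewrite ?ltnS ?ij ?(ltnW ij) ?(ltnW (ltnW ij)) ?orbT.
Qed.

Definition braid_perm (n : nat) : group_hom (braid_group n) 'S_n :=
  presented_lift (@adjacent_transposition_braid_rel n).

Lemma braid_perm_gen n (i : 'I_n.-1) :
  braid_perm n (presented_gen (@braid_rel n) i) = adjacent_transposition i.
Proof. exact: presented_lift_gen. Qed.

Definition pure_braid_group (n : nat) : groupType := kernel (braid_perm n).

(* H is an epimorphic image of G.                                            *)
Definition epimorphic_image (G H : groupType) : Prop :=
  exists f : group_hom G H, forall y, exists x, f x = y.

Definition has_corank (G : groupType) (k : nat) : Prop :=
  epimorphic_image G (free_group k) /\
  (forall m : nat, epimorphic_image G (free_group m) -> m <= k).

(* Main.v *)
From HB Require Import structures.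
Require Import Defs.
From mathcomp Require Import all_boot all_algebra fingroup perm.
From mathcomp Require Import boolp generic_quotient zify.

(** The lower bound comes from forgetting all strands but three: the pure braid
    group on three strands modulo its centre is free of rank 2.  Forgetting
    strands is not a homomorphism on the whole braid group, where it only makes
    sense as a cocycle over the action on positions: the value attached to a
    letter depends on where the three chosen strands currently are.  The cocycle
    is defined on words ([crossing], [track]), the braid relations are checked
    on it ([track_braid_rel]), and its restriction to pure braids is a
    homomorphism onto a free group of rank 2 ([free2_epimorphic]).

    For the upper bound, let f map the pure braid group onto a free group of
    rank m, and let phi be f followed by reduction of exponents mod 2, with
    values in V, a vector space of dimension m over the field with two elements.
    Commuting elements of a free group have linearly dependent exponent vectors,
    because the free group maps to a Heisenberg group ([exponents_parallel]).
    For each pair of strands a, b, the full twists of a around b form one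
    conjugacy class of the pure braid group ([twist_pure_conj]), so phi has a
    well-defined value v a b on them.  Twists of disjoint pairs commute for
    suitable representatives, and the full twist on three strands, whose value
    is v a b + v b c + v a c, commutes with the twists that it involves.  These
    two facts alone force all v a b into a subspace {0, x, y, x + y}
    ([edge_span]): if v p q and v p r are distinct and nonzero then the values
    on the triangle p q r sum to zero, and every other pair is disjoint from
    some edge of that triangle, hence has value 0 or the value of that edge.
    Finally the pure braid group is the normal closure, in the braid group, of
    the squares of the generators, which is Coxeter's presentation of the symmetric group
    ([pure_normal_closure]).  So phi takes at most four values, and being onto V
    it gives 2 ^ m <= 4.

    One normal form carries both the normal generation and the conjugacy of
    twists.  Modulo a normal subgroup D of pure braids containing the squares, a
    braid in the first t + 1 generators is h sigma_t sigma_(t-1) ... sigma_k with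
    h in the first t generators ([below_normal_form]); looking at where the
    strand t + 1 goes determines k.  An arbitrary such D gives the normal
    generation; D = all pure braids describes the stabilizer of the last two
    strands. *)

Set Implicit Arguments.
Unset Strict Implicit.
Unset Printing Implicit Defensive.

Import GRing.Theory GroupScope.
Local Open Scope group_scope.

(** * Groups given by generators and relations *)

Lemma presented_ind (X : choiceType) (R : word X -> word X -> Prop)
    (P : presented R -> Prop) :
  P 1 -> (forall x y, P x -> P y -> P (x * y)) ->
  (forall x, P (presented_gen R x)) ->
  (forall x, P (presented_gen R x)^-1) -> forall x, P x.
Proof.
move=> P1 PM Pg PV x; rewrite -(class_of_repr x).
elim: (repr x) => [//|[a b] w IHw].
have -> : class_of R ((a, b) :: w) = class_of R [:: (a, b)] * class_of R w.
  exact: (class_of_cat R [:: (a, b)] w).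
apply: PM => //; case: b; last exact: Pg.
suff -> : class_of R [:: (a, true)] = (presented_gen R a)^-1 by apply: PV.
symmetry; apply: mulg1_eq; rewrite -[RHS]/(class_of R [::]).
rewrite -[LHS]/(presented_mul _ _) -class_of_cat.
exact/class_of_eq/word_eq_cancel.
Qed.

Lemma class_of_gen_word (X : choiceType) (R : word X -> word X -> Prop) s :
  class_of R (gen_word s) = \prod_(x <- s) presented_gen R x.
Proof.
elim: s => [|x s IHs]; first by rewrite big_nil.
by rewrite big_cons -IHs; apply: (class_of_cat R (gen_word [:: x]) (gen_word s)).
Qed.

Lemma presented_rel (X : choiceType) (R : word X -> word X -> Prop) s t :
  R (gen_word s) (gen_word t) ->
  \prod_(x <- s) presented_gen R x = \prod_(x <- t) presented_gen R x.
Proof. by move=> Rst; rewrite -!class_of_gen_word; apply/class_of_eq/word_eq_rel. Qed.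

(** * Braids and their strands *)

Definition swap (i p : nat) : nat :=
  if p == i then i.+1 else if p == i.+1 then i else p.

Lemma adjacent_transpositionE n (i : 'I_n.-1) (p : 'I_n) :
  adjacent_transposition i p = swap i p :> nat.
Proof.
rewrite /swap /adjacent_transposition.
case: tpermP => [->|->|/eqP + /eqP +] /=; try by rewrite ?eqxx ?gtn_eqF.
by rewrite -!val_eqE /= => /negbTE-> /negbTE->.
Qed.

Section Sigma.

Variable n : nat.
Local Notation B := (braid_group n).

(** Natural-number indices avoid carrying bounds through the computations; the
    value 1 out of range keeps the far commutations unconditional. *)
Definition sigma (i : nat) : B :=
  if insub i is Some j then presented_gen (@braid_rel n) j else 1.

Lemma sigmaE (j : 'I_n.-1) : sigma j = presented_gen (@braid_rel n) j.
Proof. by rewrite /sigma valK. Qed.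

Lemma sigma_oversize i : n.-1 <= i -> sigma i = 1.
Proof. by move=> ni; rewrite /sigma insubF // ltnNge ni. Qed.

Lemma sigma_far i j : i.+1 < j -> commute (sigma i) (sigma j).
Proof.
move=> ij; case: (ltnP j n.-1) => [jn|/sigma_oversize->]; last exact: commute1.
have i_n : i < n.-1 by lia.
rewrite (sigmaE (Ordinal i_n)) (sigmaE (Ordinal jn)).
have := presented_rel (@braid_rel_far n (Ordinal jn) (Ordinal i_n) _).
rewrite !big_cons big_nil !mulg1; apply => /=.
by rewrite ij orbT.
Qed.

Lemma sigma_braid i : i.+1 < n.-1 ->
  sigma i * sigma i.+1 * sigma i = sigma i.+1 * sigma i * sigma i.+1.
Proof.
move=> jn; have i_n : i < n.-1 by lia.
rewrite (sigmaE (Ordinal i_n)) (sigmaE (Ordinal jn)).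
have := presented_rel (@braid_rel_adjacent n (Ordinal i_n) (Ordinal jn) (erefl _)).
by rewrite !big_cons big_nil !mulg1 !mulgA.
Qed.

Lemma braid_ind (P : B -> Prop) :
  P 1 -> (forall x y, P x -> P y -> P (x * y)) ->
  (forall i, i < n.-1 -> P (sigma i)) ->
  (forall i, i < n.-1 -> P (sigma i)^-1) -> forall x, P x.
Proof.
move=> P1 PM Ps PV; apply: presented_ind => // j; rewrite -sigmaE.
  exact: Ps.
exact: PV.
Qed.

(** Braids compose from left to right: this is the position reached by the
    strand that starts in position [a]. *)
Definition strand (x : B) (a : 'I_n) : 'I_n := braid_perm n x a.

Lemma strand1 a : strand 1 a = a.
Proof. by rewrite /strand gmulf1 perm1. Qed.

Lemma strandM x y a : strand (x * y) a = strand y (strand x a).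
Proof. by rewrite /strand gmulfM permM. Qed.

Lemma strandK x : cancel (strand x) (strand x^-1).
Proof. by move=> a; rewrite -strandM mulgV strand1. Qed.

Lemma strandKV x : cancel (strand x^-1) (strand x).
Proof. by move=> a; rewrite -strandM mulVg strand1. Qed.

Lemma strand_inj x : injective (strand x).
Proof. exact: can_inj (strandK x). Qed.

Lemma strand_sigma i a : i < n.-1 -> strand (sigma i) a = swap i a :> nat.
Proof.
move=> i_n; rewrite (sigmaE (Ordinal i_n)) /strand braid_perm_gen.
exact: adjacent_transpositionE.
Qed.

Definition pure (x : B) := forall a, strand x a = a.

Lemma pureP x : reflect (pure x) (x \in in_kernel (braid_perm n)).
Proof.
apply: (iffP eqP) => [x1 a|xP]; first by rewrite /strand x1 perm1.
by apply/permP => a; rewrite perm1; apply: xP.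
Qed.

Lemma pureM x y : pure x -> pure y -> pure (x * y).
Proof. by move=> xP yP a; rewrite strandM xP yP. Qed.

Lemma pureV x : pure x -> pure x^-1.
Proof. by move=> xP a; rewrite -{1}(xP a) strandK. Qed.

Lemma pureJ x y : pure x -> pure (x ^ y).
Proof. by move=> xP a; rewrite !strandM xP strandKV. Qed.

Lemma pure_sq i : pure (sigma i ^+ 2).
Proof.
case: (ltnP i n.-1) => [i_n|/sigma_oversize->]; last first.
  by rewrite expg1n => a; rewrite strand1.
move=> a; apply: val_inj; rewrite /= expg2 strandM !strand_sigma //.
by rewrite /swap; do !case: eqP => //; lia.
Qed.

(** * A normal form modulo the squares of the generators *)

Section Reduction.

Variable D : B -> Prop.
Hypothesis D_pure : forall x, D x -> pure x.
Hypothesis D1 : D 1.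
Hypothesis DM : forall x y, D x -> D y -> D (x * y).
Hypothesis DV : forall x, D x -> D x^-1.
Hypothesis DJ : forall x y, D x -> D (x ^ y).
Hypothesis Dsq : forall i, D (sigma i ^+ 2).

(** The subgroup generated by [D] and the first [t] generators; inverses come
    for free because the squares of the generators lie in [D]. *)
Inductive below (t : nat) : B -> Prop :=
  | below_D x : D x -> below t x
  | below_sigma i : i < t -> below t (sigma i)
  | belowM x y : below t x -> below t y -> below t (x * y).

(** sigma_t sigma_(t-1) ... with [l] factors, the last one being
    sigma_(t+1-l): a representative of a coset of the first [t] generators. *)
Fixpoint descent (t l : nat) : B :=
  if l is k.+1 then descent t k * sigma (t - k) else 1.

Lemma descent_far t l i : l + i < t ->
  commute (descent t l) (sigma i).
Proof.
elim: l => [|l IHl] lit /=; first exact/commute_sym/commute1.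
by apply/commute_sym/commuteM; [apply/commute_sym/IHl | apply: sigma_far]; lia.
Qed.

Lemma descent_shift t l i : t < n.-1 -> i < t -> t < l + i -> l <= t.+1 ->
  descent t l * sigma i.+1 = sigma i * descent t l.
Proof.
move=> tn it; elim: l => [|l IHl] //= til lt; first lia.
have [->|tli] : l = t - i \/ t < l + i by lia.
  have -> : t - i = (t - i.+1).+1 by lia.
  rewrite /=.
  have -> : t - (t - i.+1) = i.+1 by lia.
  have -> : t - (t - i.+1).+1 = i by lia.
  rewrite -!mulgA [sigma i.+1 * _]mulgA -sigma_braid; last lia.
  rewrite !mulgA; congr (_ * _ * _).
  by apply: descent_far; lia.
rewrite mulgA -IHl //; last lia.
by rewrite -!mulgA; congr (_ * _); apply: sigma_far; lia.
Qed.

(** The braids of the form h * descent t l are stable under right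
    multiplication by all generators of [below t.+1].  Multiplying by sigma_i
    either commutes past the descent, lengthens it, shortens it up to a square,
    or is transported to sigma_(i-1) on its left, according to the position of i
    relative to the last factor sigma_(t+1-l).  Stating this with an arbitrary
    [x] in normal form makes the case of a product of two factors immediate. *)
Lemma below_normal_form t x y : t < n.-1 -> below t.+1 y ->
  (exists2 h, below t h & exists2 l, l <= t.+1 & x = h * descent t l) ->
  (exists2 h, below t h & exists2 l, l <= t.+1 & x * y = h * descent t l).
Proof.
move=> tn ylow; elim: ylow x => {y} [y Dy|i it|y z _ IHy _ IHz] x.
- move=> [h hl [l lt ->]]; exists (h * y ^ (descent t l)^-1).
    by apply: belowM => //; apply/below_D/DJ.
  by exists l; rewrite // -[RHS]mulgA -conjgCV mulgA.
- move=> [h hl [l lt ->]].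
  have [lit|[ti|[ti|til]]] : l + i < t \/ l + i = t \/ l + i = t.+1 \/ t.+1 < l + i.
  + lia.
  + exists (h * sigma i); first by apply: belowM => //; apply: below_sigma; lia.
    by exists l; rewrite // -!mulgA; congr (_ * _); apply: descent_far; lia.
  + exists h => //; exists l.+1; first lia.
    by rewrite /= mulgA; congr (_ * sigma _); lia.
  + case: l lt ti => [|l] lt ti; first lia.
    exists (h * (sigma i ^+ 2) ^ (descent t l)^-1).
      by apply: belowM => //; apply/below_D/DJ.
    exists l; first lia.
    rewrite /= -[RHS]mulgA -conjgCV expg2 -!mulgA; congr (_ * (_ * (sigma _ * _))).
    by lia.
  + case: i it til => [|i] it til; first lia.
    exists (h * sigma i); first by apply: belowM => //; apply: below_sigma; lia.
    by exists l; rewrite // -!mulgA descent_shift //; lia.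
- by rewrite mulgA => /IHy/IHz.
Qed.

Lemma strand_below t x (a : 'I_n) : below t x -> t < a -> strand x a = a.
Proof.
move=> + ta; elim=> {x} [x /D_pure-> //|i it|x y _ IHx _ IHy].
  apply: val_inj; have i_n : i < n.-1 by move: (ltn_ord a); lia.
  by rewrite /= strand_sigma // /swap; do !case: eqP => //; lia.
by rewrite strandM IHx.
Qed.

Lemma strand_descent t l (a : 'I_n) : a = t.+1 :> nat -> l <= t.+1 ->
  strand (descent t l) a = t.+1 - l :> nat.
Proof.
move=> at1; have tn := ltn_ord a.
elim: l => [|l IHl] lt /=; first by rewrite strand1 subn0.
rewrite strandM strand_sigma ?IHl; [|lia|lia].
by rewrite /swap; do !case: eqP => //; lia.
Qed.

(** The descent moves the strand t + 1 to the position t + 1 - l, while the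
    first factor of the normal form fixes it. *)
Lemma below_fix t x (a : 'I_n) : a = t.+1 :> nat ->
  below t.+1 x -> strand x a = a -> below t x.
Proof.
move=> at1 xl; have tn := ltn_ord a.
have: exists2 h, below t h & exists2 l, l <= t.+1 & 1 * x = h * descent t l.
  apply: below_normal_form => //; first lia.
  by exists 1; [apply: below_D | exists 0; rewrite ?mulg1].
rewrite mul1g => -[h hl [l lt ->]].
rewrite strandM (strand_below hl); last lia.
move/(congr1 val); rewrite /= strand_descent // at1 => ltt.
by have -> : l = 0; [lia | rewrite mulg1].
Qed.

Lemma below_full x : below n.-1 x.
Proof.
elim/braid_ind: x => [|x y|i i_n|i i_n]; [exact: below_D|exact: belowM| |].
  exact: below_sigma.
have -> : (sigma i)^-1 = (sigma i ^+ 2)^-1 * sigma i by rewrite expg2 invgM mulgVK.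
by apply: belowM; [apply/below_D/DV | apply: below_sigma].
Qed.

(** A pure braid fixes all strands, so the generators can be peeled off one by
    one from the top. *)
Lemma pure_normal_closure x : pure x -> D x.
Proof.
move=> xP; have: below 0 x.
  have: below n.-1 x by apply: below_full.
  have: n.-1 < n \/ n.-1 = 0 by lia.
  elim: n.-1 => [//|t IHt] [tn|//] /(below_fix (a := Ordinal tn) (erefl _)) xt.
  by apply: IHt; [left; apply: ltnW|apply: xt; apply: xP].
by elim=> {x xP} // x y _ Dx _ Dy; apply: DM.
Qed.

End Reduction.

(** * Full twists of two strands *)

Lemma pure1 : pure 1. Proof. exact: strand1. Qed.

Definition pure_conj (x y : B) := exists2 p, pure p & y = x ^ p.

Lemma pure_conjJ x y g : pure_conj x y -> pure_conj (x ^ g) (y ^ g).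
Proof.
by move=> [p pP ->]; exists (p ^ g); [exact: pureJ | rewrite -conjJg].
Qed.

Lemma pure_conj_trans x y z : pure_conj x y -> pure_conj y z -> pure_conj x z.
Proof.
by move=> [p pP ->] [q qP ->]; exists (p * q); [exact: pureM | rewrite conjgM].
Qed.

Lemma sigma_conj i : i.+1 < n.-1 -> sigma i ^ (sigma i.+1 * sigma i) = sigma i.+1.
Proof. by move=> i_n; rewrite conjgE [sigma i * _]mulgA sigma_braid // mulKg. Qed.

(** A braid that fixes the last two strands lies, up to pure braids, in the
    subgroup of the generators that commute with the last one. *)
Lemma pure_conj_stabilizer (c d : 'I_n) g : c.+1 = d -> d.+1 = n ->
  strand g c = c -> strand g d = d ->
  pure_conj (sigma c ^+ 2) (sigma c ^+ 2 ^ g).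
Proof.
move=> cd dn gc gd.
have DJ x y : pure x -> pure (x ^ y) by apply: pureJ.
have lfix := below_fix (fun _ => id) pure1 DJ pure_sq.
have {gc gd} gl : below pure c.-1 g.
  have := below_full pure1 pureV pure_sq g.
  have -> : n.-1 = c.+1 by lia.
  move/lfix => /(_ d (esym cd) gd).
  case: (posnP c) => [-> //|c0]; rewrite -{1}(prednK c0).
  by move/lfix; apply; rewrite ?prednK.
elim: gl => {g} [x xP|i ic|x y _ IHx _ IHy]; first by exists x.
  exists 1; first exact: pure1.
  rewrite conjg1; apply/conjg_fixP/commgP/commute_sym.
  by rewrite expg2; apply: commuteM; apply: sigma_far; lia.
by rewrite conjgM; apply: (pure_conj_trans IHy); apply: pure_conjJ.
Qed.

(** The full twists of the strands that start in [a] and [b], as conjugates of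
    the square of the last generator by a braid bringing the last two strands to
    [a] and [b].  The last pair is the reference because its stabilizer is what
    the normal form describes. *)
Definition is_twist (a b : 'I_n) (x : B) := exists (c d : 'I_n) g,
  [/\ c.+1 = d, d.+1 = n, strand g c = a, strand g d = b
    & x = sigma c ^+ 2 ^ g].

Lemma twist_neq a b x : is_twist a b x -> a != b.
Proof.
move=> [c [d [g [cd _ <- <- _]]]]; rewrite (inj_eq (@strand_inj g)) -val_eqE /=.
by rewrite -cd ltn_eqF.
Qed.

(** The conjugating braid may be preceded by the last generator itself, which
    commutes with its square. *)
Lemma twist_sym a b x : is_twist a b x -> is_twist b a x.
Proof.
move=> [c [d [g [cd dn <- <- ->]]]].
have c_n : c < n.-1 by lia.
exists c, d, (sigma c * g); split=> //; rewrite ?strandM.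
- congr strand; apply: val_inj; rewrite /= strand_sigma //.
  by rewrite /swap; do !case: eqP => //=; lia.
- congr strand; apply: val_inj; rewrite /= strand_sigma //.
  by rewrite /swap; do !case: eqP => //=; lia.
- rewrite conjgM; congr (_ ^ g); apply/esym/conjg_fixP/commgP.
  exact/commute_sym/commuteX.
Qed.

Lemma twistJ a b x g : is_twist a b x -> is_twist (strand g a) (strand g b) (x ^ g).
Proof.
move=> [c [d [h [cd dn <- <- ->]]]].
by exists c, d, (h * g); split=> //; rewrite ?strandM ?conjgM.
Qed.

Lemma twist_pure_conj a b x y : is_twist a b x -> is_twist a b y -> pure_conj x y.
Proof.
move=> [c [d [g [cd dn ga gb ->]]]] [c' [d' [h [cd' dn' ha hb ->]]]].
have ec : c' = c by apply: val_inj => /=; lia.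
have ed : d' = d by apply: val_inj => /=; lia.
rewrite {}ec {}ed in ha hb cd' *.
rewrite -[h](mulgVK g) [_ ^ (_ * g)]conjgM; apply: pure_conjJ.
apply: (pure_conj_stabilizer cd dn); rewrite strandM ?ha ?hb.
  by rewrite -ga strandK.
by rewrite -gb strandK.
Qed.

(** Consecutive generators are conjugate by a braid carrying one pair of
    positions to the other, so one can climb down from the last generator. *)
Lemma twist_sigma (a b : 'I_n) : a.+1 = b -> is_twist a b (sigma a ^+ 2).
Proof.
have [k] : exists k, k + b = n.-1 by exists (n.-1 - b); have := ltn_ord b; lia.
elim: k a b => [|k IHk] a b kb ab.
  by exists a, b, 1; rewrite !strand1 conjg1; split=> //; move: (ltn_ord b); lia.
have c_n : b.+1 < n by lia.
pose c := Ordinal c_n.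
have bc : is_twist b c (sigma b ^+ 2) by apply: IHk => //=; lia.
have a_n : a.+1 < n.-1 by lia.
set h := sigma a.+1 * sigma a.
have ha : strand h a = b.
  apply: val_inj; rewrite /= strandM !strand_sigma; try lia.
  by rewrite /swap; do !case: eqP => //=; lia.
have hb : strand h b = c.
  apply: val_inj; rewrite /= strandM !strand_sigma; try lia.
  by rewrite /swap; do !case: eqP => //=; lia.
have -> : sigma a ^+ 2 = sigma b ^+ 2 ^ h^-1.
  by rewrite -ab conjXg -(sigma_conj a_n) -/h conjgK.
have := twistJ h^-1 bc.
have -> : strand h^-1 b = a by rewrite -ha strandK.
by have -> : strand h^-1 c = b by rewrite -hb strandK.
Qed.

Lemma strand_surj (s : 'S_n) : exists x, strand x =1 s.
Proof.
suff [x xs] : exists x, braid_perm n x = s by exists x; rewrite /strand xs.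
have im_adj k (a b : 'I_n) : a + k.+1 = b -> exists x, braid_perm n x = tperm a b.
  elim: k a b => [|k IHk] a b ab.
    have a_n : a < n.-1 by have := ltn_ord b; lia.
    exists (sigma a); rewrite (sigmaE (Ordinal a_n)) braid_perm_gen.
    by congr tperm; apply: val_inj => //=; lia.
  have c_n : a + k.+1 < n by have := ltn_ord b; lia.
  have [x xE] := IHk a (Ordinal c_n) (erefl _).
  have i_n : a + k.+1 < n.-1 by have := ltn_ord b; lia.
  exists (x ^ sigma (a + k.+1)); rewrite gmulfJ xE (sigmaE (Ordinal i_n)).
  rewrite braid_perm_gen tpermJ; congr tperm.
    by rewrite tpermD // -val_eqE /=; lia.
  have -> : Ordinal c_n = Ordinal (ltnW (braid_index_lt (Ordinal i_n))).
    exact: val_inj.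
  by rewrite tpermL; apply: val_inj => /=; lia.
have im_tperm (a b : 'I_n) : exists x, braid_perm n x = tperm a b.
  have [ab|ba|/val_inj->] := ltngtP a b.
  - by apply: (im_adj (b - a.+1)); lia.
  - by rewrite tpermC; apply: (im_adj (a - b.+1)); lia.
  - by exists 1; rewrite gmulf1 tperm1.
have [ts -> _] := prod_tpermP s.
elim: ts => [|t ts [x xE]]; first by exists 1; rewrite gmulf1 big_nil.
have [y yE] := im_tperm t.1 t.2.
by exists (y * x); rewrite gmulfM big_cons xE yE.
Qed.

Lemma perm_map_uniq (T : finType) (s t : seq T) :
  size s = size t -> uniq s -> uniq t -> exists p : {perm T}, map p s = t.
Proof.
elim: s t => [|x s IHs] [|y t] //=; first by exists 1.
move=> [/IHs{}IHs] /andP[xs us] /andP[yt ut]; have [p pE] := IHs us ut.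
exists (p * tperm (p x) y); rewrite permM tpermL; congr cons.
rewrite -[RHS]pE; apply/eq_in_map => z zs; rewrite permM tpermD //.
  by rewrite (inj_eq perm_inj); apply: contraNneq xs => ->.
by apply: contraNneq yt => ->; rewrite -pE map_f.
Qed.

Lemma strand_map_uniq (s t : seq 'I_n) :
  size s = size t -> uniq s -> uniq t -> exists x, map (strand x) s = t.
Proof.
move=> st us ut; have [p <-] := perm_map_uniq st us ut.
by have [x xp] := strand_surj p; exists x; apply: eq_map.
Qed.

Lemma twist_exists a b : a != b -> exists x, is_twist a b x.
Proof.
move=> ab; have n1 : 1%N < n.
  by case: n a b ab => [[]//|[|m]] // a b; rewrite !ord1.
pose o0 := Ordinal (ltnW n1); pose o1 := Ordinal n1.
have [//|//||g [<- <-]] := @strand_map_uniq [:: o0; o1] [:: a; b].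
  by rewrite /= inE ab.
by exists (sigma o0 ^+ 2 ^ g); apply/twistJ/twist_sigma.
Qed.

(** Bring [a], [b], [c], [d] from the first four positions, where sigma_0 and
    sigma_2 commute. *)
Lemma twist_disjoint a b c d : uniq [:: a; b; c; d] ->
  exists x y, [/\ is_twist a b x, is_twist c d y & commute x y].
Proof.
move=> u; have n3 : 3 < n.
  rewrite -[n]card_ord; apply: leq_trans (max_card [in [:: a; b; c; d]]).
  by rewrite (card_uniqP u).
pose o i (lt_i : i <= 3) := Ordinal (leq_ltn_trans lt_i n3).
pose o0 := o 0%N isT; pose o1 := o 1%N isT; pose o2 := o 2 isT; pose o3 := o 3 isT.
have [//|//|//|g [<- <- <- <-]] := @strand_map_uniq [:: o0; o1; o2; o3] [:: a; b; c; d].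
exists (sigma o0 ^+ 2 ^ g), (sigma o2 ^+ 2 ^ g); split.
- exact/twistJ/twist_sigma.
- exact/twistJ/twist_sigma.
- rewrite /commute -!conjMg; congr (_ ^ g).
  exact/commuteX2/sigma_far.
Qed.

(** The element is the square of D = x y x, and conjugation by D exchanges [x]
    and [y].  In the braid group on three strands it is the full twist, written
    as the product of the full twists of the three pairs. *)
Lemma full_twist_commute (G : groupType) (x y : G) : x * y * x = y * x * y ->
  commute x (y ^+ 2 * x ^+ 2 ^ y * x ^+ 2).
Proof.
move=> xyx; pose D := x * y * x.
have xD : x * D = D * y by rewrite /D {1}xyx !mulgA.
have yD : y * D = D * x by rewrite /D {2}xyx !mulgA.
have -> : y ^+ 2 * x ^+ 2 ^ y * x ^+ 2 = D * D.
  have -> : y ^+ 2 * x ^+ 2 ^ y * x ^+ 2 = y * x * (x * y * x) * x.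
    by rewrite conjgE !expg2 !mulgA mulgK.
  by rewrite {1}xyx /D {1}xyx !mulgA.
by rewrite /commute mulgA xD -mulgA yD mulgA.
Qed.

Lemma twist_triangle a b c : uniq [:: a; b; c] -> exists x y z,
  [/\ is_twist a b x, is_twist b c y, is_twist a c z & commute x (y * z * x)].
Proof.
move=> u; have n2 : 2 < n.
  rewrite -[n]card_ord; apply: leq_trans (max_card [in [:: a; b; c]]).
  by rewrite (card_uniqP u).
pose o i (lt_i : i <= 2) := Ordinal (leq_ltn_trans lt_i n2).
pose o0 := o 0%N isT; pose o1 := o 1%N isT; pose o2 := o 2 isT.
have [//|//|//|g [<- <- <-]] := @strand_map_uniq [:: o0; o1; o2] [:: a; b; c].
exists (sigma o0 ^+ 2 ^ g), (sigma o1 ^+ 2 ^ g), ((sigma o0 ^+ 2 ^ sigma o1) ^ g); split.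
- exact/twistJ/twist_sigma.
- exact/twistJ/twist_sigma.
- have n1 : 1%N < n.-1 by lia.
  have s0 : strand (sigma o1) o0 = o0.
    by apply: val_inj; rewrite /= strand_sigma.
  have s2 : strand (sigma o1) o1 = o2.
    by apply: val_inj; rewrite /= strand_sigma.
  have t01 : is_twist o0 o1 (sigma o0 ^+ 2) by apply: twist_sigma.
  by have := twistJ g (twistJ (sigma o1) t01); rewrite s0 s2.
- rewrite /commute -!conjMg; congr (_ ^ g).
  have braid : sigma o0 * sigma o1 * sigma o0 = sigma o1 * sigma o0 * sigma o1.
    by apply: sigma_braid; rewrite /=; lia.
  exact/commute_sym/commuteX/commute_sym/(full_twist_commute braid).
Qed.

Lemma twist_pure a b x : is_twist a b x -> pure x.
Proof. by move=> [c [d [g [_ _ _ _ ->]]]]; apply/pureJ/pure_sq. Qed.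

End Sigma.

(** * Linear dependence over the field with two elements *)

(** Linear dependence of two vectors when 0 and 1 are the only scalars. *)
Definition parallel (V : zmodType) (x y : V) := [\/ x = 0%R, y = 0%R | x = y].

(** [v] is a labelling of the edges of a complete graph.  If all nonzero labels
    are equal there is nothing to do.  Otherwise two edges with distinct nonzero
    labels cannot be disjoint, so they are p q and p r; both labels are parallel
    to the sum over the triangle p q r, which must then vanish.  The three labels
    of the triangle are nonzero, and any edge that is not in the triangle avoids
    at least two of its vertices, so it is parallel to the edge between them. *)
Lemma edge_span (I : eqType) (V : zmodType) (v : I -> I -> V) :
  (forall x : V, x + x = 0)%R ->
  (forall a b, v a b = v b a) ->
  (forall a b c d, uniq [:: a; b; c; d] -> parallel (v a b) (v c d)) ->
  (forall a b c, uniq [:: a; b; c] -> parallel (v a b) (v a b + v b c + v a c)%R) ->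
  exists x y : V, forall a b, a != b -> v a b \in [:: 0; x; y; x + y]%R.
Proof.
move=> V2 vC vD vT.
have VN (x : V) : (- x = x)%R.
  by apply/eqP; rewrite eq_sym -subr_eq0 opprK V2.
have [[p [q [r [u pq pr pqr]]]]|triv] := pselect (exists p q r,
   [/\ uniq [:: p; q; r], v p q != 0%R, v p r != 0%R & v p q != v p r]).
  have t0 : (v p q + v q r + v p r = 0)%R.
    have := vT p q r u; case=> [/eqP|//|pqt]; first by rewrite (negbTE pq).
    have: parallel (v p r) (v p q + v q r + v p r)%R.
      have -> : (v p q + v q r + v p r = v p r + v r q + v p q)%R.
        by rewrite [v r q]vC [RHS]addrC [RHS]addrA [RHS]addrAC.
      apply: vT; move: u; rewrite /= !inE !negb_or ![r == _]eq_sym.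
      by case/and3P => /andP[-> ->] ->.
    case=> [/eqP|//|prt]; first by rewrite (negbTE pr).
    by case/eqP: pqr; rewrite pqt -prt.
  have qrE : v q r = (v p q + v p r)%R.
    by apply/eqP; rewrite -subr_eq0 VN addrCA addrA t0.
  exists (v p q), (v p r) => a b ab.
  have qr : v q r != 0%R by rewrite qrE addr_eq0 VN.
  (* [on] treats the edges of the triangle, [off] those disjoint from one. *)
  have on c d : c \in [:: a; b] -> d \in [:: a; b] -> c != d -> v a b = v c d.
    by rewrite !inE => /orP[]/eqP-> /orP[]/eqP->; rewrite ?eqxx // => _; apply: vC.
  have off c d : c \notin [:: a; b] -> d \notin [:: a; b] -> c != d ->
      v c d != 0%R -> v a b = 0%R \/ v a b = v c d.
    rewrite !inE !negb_or => /andP[ca cb] /andP[da db] cd /eqP cd0.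
    have /vD[->|//|->] : uniq [:: a; b; c; d]; [|by left|by right].
    by rewrite /= !inE !negb_or ab cd !(eq_sym a) !(eq_sym b) ca cb da db.
  move: u; rewrite /= !inE negb_or -!andbA => /and4P[npq npr nqr _].
  rewrite -qrE; case: (boolP (p \in [:: a; b])) => [pab|pab];
    case: (boolP (q \in [:: a; b])) => [qab|qab];
    case: (boolP (r \in [:: a; b])) => [rab|rab];
    try by [rewrite (on p q) ?eqxx ?orbT | rewrite (on p r) ?eqxx ?orbT
           |rewrite (on q r) ?eqxx ?orbT
           |have [||//||->|->] := off p q; rewrite // ?eqxx ?orbT
           |have [||//||->|->] := off p r; rewrite // ?eqxx ?orbT
           |have [||//||->|->] := off q r; rewrite // ?eqxx ?orbT].
(* From here on two nonzero labels sharing a vertex are equal. *)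
case: (pselect (exists p q, p != q /\ v p q != 0%R)) => [[p [q [pq vpq]]]|triv2].
  have star c d e : c != d -> c != e -> v c d = v p q ->
      v c e \in [:: 0; v p q; 0; v p q + 0]%R.
    move=> cd ce cdE; have [<-|de] := eqVneq d e.
      by rewrite cdE !inE eqxx orbT.
    rewrite !inE; have [->|ce0] := eqVneq (v c e) 0%R => //.
    have [->|cde] := eqVneq (v c e) (v p q); first by rewrite orbT.
    case: triv; exists c, d, e; rewrite /= !inE negb_or cd ce de cdE vpq ce0.
    by rewrite eq_sym cde.
  exists (v p q), 0%R => a b ab.
  have [pa|ap] := eqVneq p a.
    by rewrite -pa in ab *; apply: (star p q).
  have [<-|bp] := eqVneq p b.
    by rewrite vC; apply: (star p q) => //; rewrite eq_sym.
  have qp : q != p by rewrite eq_sym.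
  have [qa|aq] := eqVneq q a.
    by rewrite -qa in ab *; apply: (star q p).
  have [<-|bq] := eqVneq q b.
    by rewrite vC; apply: (star q p) => //; rewrite eq_sym.
  have /vD[->|/eqP|->] : uniq [:: a; b; p; q]; rewrite ?inE ?eqxx ?orbT //.
    by rewrite /= !inE !negb_or ab pq !(eq_sym a) !(eq_sym b) ap bp aq bq.
  by rewrite (negbTE vpq).
exists 0%R, 0%R => a b ab; rewrite !inE; apply/orP; left.
by apply: contra_notT triv2 => vab; exists a, b.
Qed.

(** * Commuting elements of a free group *)

Section Heisenberg.

Variables (F : fieldType) (m : nat).
Local Open Scope ring_scope.

(** A central extension of the vectors by the bilinear forms: two elements
    commute exactly when the tensor product of their vectors is symmetric, that
    is, when the vectors are dependent.  One target of this size tests all pairs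
    of coordinates at once. *)
Definition heisenberg : Type := ('rV[F]_m * 'M[F]_m)%type.
HB.instance Definition _ := Choice.on heisenberg.

Implicit Types x y z : heisenberg.

Definition heisenberg_mul x y : heisenberg :=
  (x.1 + y.1, x.2 + y.2 + x.1^T *m y.1).
Definition heisenberg_one : heisenberg := (0, 0).
Definition heisenberg_inv x : heisenberg := (- x.1, - x.2 + x.1^T *m x.1).

Fact heisenberg_mulA : associative heisenberg_mul.
Proof.
move=> x y z; congr pair; rewrite /= ?addrA //.
rewrite mulmxDr [(_ + _)^T]linearD /= mulmxDl !addrA.
by rewrite [LHS](+%R.[ACl 1*2*5*3*6*4]).
Qed.

Fact heisenberg_1mul : left_id heisenberg_one heisenberg_mul.
Proof. by move=> [u M]; congr pair; rewrite /= ?linear0 ?mul0mx ?add0r ?addr0. Qed.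

Fact heisenberg_mul1 : right_id heisenberg_one heisenberg_mul.
Proof. by move=> [u M]; congr pair; rewrite /= ?mulmx0 ?addr0. Qed.

Fact heisenberg_Vmul : left_inverse heisenberg_one heisenberg_inv heisenberg_mul.
Proof.
move=> [u M]; congr pair; rewrite /= ?addNr //.
by rewrite [(- u)^T]linearN /= mulNmx addrAC addrK addNr.
Qed.

Fact heisenberg_mulV : right_inverse heisenberg_one heisenberg_inv heisenberg_mul.
Proof.
move=> [u M]; congr pair; rewrite /= ?addrN //.
by rewrite mulmxN addrA subrr add0r subrr.
Qed.

HB.instance Definition _ := isGroup.Build heisenberg heisenberg_mulA
  heisenberg_1mul heisenberg_mul1 heisenberg_Vmul heisenberg_mulV.

Lemma heisenberg_commute x y : commute x y -> x.1^T *m y.1 = y.1^T *m x.1.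
Proof. by case=> _; rewrite [y.2 + _]addrC => /addrI. Qed.

Fact free_heisenberg_rel (u v : word 'I_m) : False ->
  eval_word (fun i => (delta_mx 0 i, 0) : heisenberg) u =
  eval_word (fun i => (delta_mx 0 i, 0) : heisenberg) v.
Proof. by []. Qed.

(** Freeness is used here: the basis vectors of the abelianization can be lifted
    to the Heisenberg group with no relation to check. *)
Definition free_heisenberg : group_hom (free_group m) heisenberg :=
  presented_lift free_heisenberg_rel.

Definition exponents (x : free_group m) : 'rV[F]_m := (free_heisenberg x).1.

Lemma exponentsM (x y : free_group m) : exponents (x * y)%g = exponents x + exponents y.
Proof. by rewrite /exponents gmulfM. Qed.

Lemma exponents_gen i : exponents (presented_gen _ i) = delta_mx 0 i.
Proof. by rewrite /exponents [free_heisenberg _]presented_lift_gen. Qed.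

Lemma exponents_commute (x y : free_group m) : commute x y ->
  (exponents x)^T *m exponents y = (exponents y)^T *m exponents x.
Proof. by move=> xy; apply/heisenberg_commute/gmulf_commute. Qed.

End Heisenberg.

Lemma F2P (c : 'F_2) : c = 0%R \/ c = 1%R.
Proof. by case: c => [[|[|//]] c]; [left|right]; apply: val_inj. Qed.

Lemma exponents_parallel m (x y : free_group m) : commute x y ->
  parallel (exponents 'F_2 x) (exponents 'F_2 y).
Proof.
move/(exponents_commute 'F_2); move: (exponents _ x) (exponents _ y) => u w uw.
have [->|u0] := eqVneq u 0%R; first by constructor 1.
have /existsP[i ui] : [exists i, u ord0 i != 0%R].
  apply: contraNT u0 => /existsPn u0; apply/eqP/rowP => i.
  by rewrite mxE; apply/eqP; have := u0 i; rewrite negbK.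
have u1 : u ord0 i = 1%R by case: (F2P (u ord0 i)) ui => ->; rewrite ?eqxx.
have wE j : w ord0 j = (w ord0 i * u ord0 j)%R.
  have := congr1 (fun A : 'M_m => A i j) uw.
  by rewrite !mxE !big_ord1 !mxE u1 mul1r.
have [w0|w1] := F2P (w ord0 i).
  by constructor 2; apply/rowP => j; rewrite wE w0 mul0r mxE.
by constructor 3; apply/rowP => j; rewrite wE w1 mul1r.
Qed.

Lemma exponents_surj m (u : 'rV['F_2]_m) : exists x, exponents 'F_2 x = u.
Proof.
rewrite (row_sum_delta u); elim/big_ind: _ => [|a b [x <-] [y <-]|i _].
- by exists 1; rewrite /exponents gmulf1.
- by exists (x * y); rewrite exponentsM.
- have [->|->] := F2P (u ord0 i).
    by exists 1; rewrite /exponents gmulf1 scale0r.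
  by exists (presented_gen _ i); rewrite exponents_gen scale1r.
Qed.

(** * The upper bound *)

Section Values.

Variables (n : nat) (V : zmodType) (phi : braid_group n -> V).
Hypothesis V2 : forall x : V, (x + x = 0)%R.
Hypothesis phiM : forall x y, pure x -> pure y -> phi (x * y) = (phi x + phi y)%R.
Hypothesis phiC : forall x y, pure x -> pure y -> commute x y ->
  parallel (phi x) (phi y).

Lemma phi_pure_conj x y : pure x -> pure_conj x y -> phi y = phi x.
Proof.
move=> xP [p pP ->]; apply: (addrI (phi p)).
by have xpP := pureJ p xP; rewrite -phiM // -conjgC phiM // addrC.
Qed.

(** The set {0, x, y, x + y} provided by [edge_span] is a subgroup, so the pure
    braids all of whose conjugates have their value in it form a normal subgroup
    of the whole braid group; it contains the squares of the generators, whose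
    conjugates are twists. *)
Lemma phi_span : exists x y : V, forall g, pure g ->
  phi g \in [:: 0; x; y; x + y]%R.
Proof.
(* Coinciding strands have no twist; the value 1 there is never looked at. *)
pose tw (a b : 'I_n) : braid_group n :=
  if pselect (exists x, is_twist a b x) is left e then projT1 (cid e) else 1.
have twP a b : a != b -> is_twist a b (tw a b).
  move=> /twist_exists e; rewrite /tw; case: pselect => // e'.
  by case: (cid e').
have twE a b x : is_twist a b x -> phi (tw a b) = phi x.
  move=> xP; apply: phi_pure_conj; first exact: twist_pure xP.
  by apply: (twist_pure_conj xP (twP _ _ (twist_neq xP))).
have [||a b c d u|a b c u|x [y xyP]] := @edge_span _ V (fun a b => phi (tw a b)).
- exact: V2.
- move=> a b; have [->//|ab] := eqVneq a b.
  by apply/twE/twist_sym/twP; rewrite eq_sym.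
- have [x [y [xP yP xy]]] := twist_disjoint u.
  by rewrite (twE _ _ _ xP) (twE _ _ _ yP); apply: phiC xy;
    [apply: twist_pure xP|apply: twist_pure yP].
- have [x [y [z [xP yP zP xyz]]]] := twist_triangle u.
  rewrite (twE _ _ _ xP) (twE _ _ _ yP) (twE _ _ _ zP).
  have px := twist_pure xP; have py := twist_pure yP; have pz := twist_pure zP.
  have -> : (phi x + phi y + phi z = phi (y * z * x)%g)%R.
    by rewrite !phiM //; [rewrite -addrA addrC|apply: pureM].
  by apply: phiC => //; do 2!apply: pureM => //.
exists x, y => g gP.
set W := [:: _; _; _; _] in xyP *.
have W0 : 0%R \in W by rewrite inE eqxx.
have WD u v : u \in W -> v \in W -> (u + v)%R \in W.
  have yx : (y + x = x + y)%R by rewrite addrC.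
  have xxy : (x + (x + y) = y)%R by rewrite addrA V2 add0r.
  have yxy : (y + (x + y) = x)%R by rewrite addrCA V2 addr0.
  have xyx : (x + y + x = y)%R by rewrite addrAC V2 add0r.
  have xyy : (x + y + y = x)%R by rewrite -addrA V2 addr0.
  rewrite !inE => /or4P[]/eqP-> /or4P[]/eqP->;
    by rewrite ?(add0r, addr0, V2, yx, xxy, yxy, xyx, xyy) eqxx ?orbT.
have phi1 : phi 1 = 0%R.
  by apply: (addrI (phi 1)); rewrite -phiM ?mulg1 ?addr0 //; apply: pure1.
pose D g := pure g /\ forall h, phi (g ^ h) \in W.
suff: D g by case=> _ /(_ 1); rewrite conjg1.
apply: pure_normal_closure gP => {g}.
- by move=> g [].
- by split=> [|h]; [exact: pure1 | rewrite conj1g phi1].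
- move=> g h [gP gW] [hP hW]; split=> [|k]; first exact: pureM.
  by rewrite conjMg phiM ?WD //; apply: pureJ.
- move=> g [gP gW]; split=> [|k]; first exact: pureV.
  rewrite conjVg; have <- : phi (g ^ k) = phi (g ^ k)^-1; last exact: gW.
  have gkP := pureJ k gP; have gkVP := pureV gkP.
  by apply: (addrI (phi (g ^ k))); rewrite V2 -phiM // mulgV phi1.
- by move=> g h [gP gW]; split=> [|k]; [exact: pureJ|rewrite -conjgM].
- move=> i; split=> [|h]; first exact: pure_sq.
  have [i_n|/sigma_oversize->] := ltnP i n.-1; last by rewrite expg1n conj1g phi1.
  have i0 : i < n by lia.
  have i1 : i.+1 < n by lia.
  have /(twistJ h) t : is_twist (Ordinal i0) (Ordinal i1) (sigma n i ^+ 2).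
    exact: twist_sigma.
  by rewrite -(twE _ _ _ t); apply/xyP/(twist_neq t).
Qed.

End Values.

Lemma corank_le2 n m : epimorphic_image (pure_braid_group n) (free_group m) -> m <= 2.
Proof.
move=> [f f_surj].
pose phi (x : braid_group n) : 'rV['F_2]_m :=
  if insub x is Some p then exponents 'F_2 (f p) else 0%R.
have phiE (p : pure_braid_group n) : phi (val p) = exponents 'F_2 (f p).
  by rewrite /phi valK.
have purE x : pure x -> exists p : pure_braid_group n, val p = x.
  by move=> /pureP xP; exists (Sub x xP); rewrite SubK.
have [x|x y /purE[p <-] /purE[q <-]|x y /purE[p <-] /purE[q <-] pq|u [v uv]] :=
  @phi_span n _ phi.
- apply/rowP => i; rewrite !mxE; case: (x ord0 i) => [[|[|//]] c]; exact: val_inj.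
- by rewrite -valM !phiE gmulfM exponentsM.
- rewrite !phiE; apply: exponents_parallel; apply: gmulf_commute.
  by apply: val_inj; rewrite !valM.
have: (#|{: 'rV['F_2]_m}| <= 4)%N.
  apply: leq_trans (card_size [:: 0; u; v; u + v]%R).
  apply/subset_leq_card/subsetP => w _.
  have [x <-] := exponents_surj w; have [p <-] := f_surj x.
  by rewrite -phiE; apply: uv; apply/pureP/valP.
rewrite card_mx card_Fp // mul1n => m4.
by rewrite -(leq_exp2l (m := 2)).
Qed.

(** * The lower bound *)

Section Cocycle.

Variables (K : groupType) (x y : K).

(** The value of the generator exchanging the positions i and i + 1 when the
    strands 0, 1, 2 are in positions p, q, r.  Only the crossings of two of these
    strands count, and only those that restore the natural order of the two: the
    other ones are normalized to 1, as in a Garside normal form.  Then the pure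
    braid group on three strands is < x, y, z | x y z = y z x = z x y >, where x
    and y belong to the pairs {0, 1} and {1, 2}, and where z belongs to {0, 2}
    with strand 1 on the left, while with strand 1 on the right the value is
    x^-1 z x.  Killing the central element x y z gives z = y^-1 x^-1. *)
Definition crossing (p q r i : nat) : K :=
  if (p == i.+1) && (q == i) then x
  else if (q == i.+1) && (r == i) then y
  else if (p == i.+1) && (r == i) then
    (if q < i then y^-1 * x^-1 else x^-1 * y^-1)
  else 1.

(** The rewriting rules that simplify a comparison or an exchange involving a
    position outside {i, i + 1, i + 2}. *)
Definition outside (i p : nat) :=
  (((p == i) = false) * ((p == i.+1) = false) * ((p == i.+2) = false) *
  ((p < i.+1) = (p < i)) * (swap i p = p) * (swap i.+1 p = p))%type.

Variant window_spec (i p : nat) : nat -> Type :=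
  | Window0 : window_spec i p i
  | Window1 : window_spec i p i.+1
  | Window2 : window_spec i p i.+2
  | WindowOut of outside i p : window_spec i p p.

Lemma windowP i p : window_spec i p p.
Proof.
have [->|p0] := eqVneq p i; first exact: Window0.
have [->|p1] := eqVneq p i.+1; first exact: Window1.
have [->|p2] := eqVneq p i.+2; first exact: Window2.
have p3 : (p < i.+1) = (p < i) by lia.
by apply: WindowOut; rewrite /outside /swap p3 !(negbTE p0, negbTE p1, negbTE p2).
Qed.

(** After locating p, q, r in the window {i, i + 1, i + 2} or outside it, both
    sides become explicit words in [x] and [y].  The only case that involves the
    choice of the value on {0, 2} is that of three strands in the window. *)
Lemma crossing_braid p q r i : p != q -> q != r -> p != r ->
  crossing p q r i * crossing (swap i p) (swap i q) (swap i r) i.+1 *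
    crossing (swap i.+1 (swap i p)) (swap i.+1 (swap i q)) (swap i.+1 (swap i r)) i =
  crossing p q r i.+1 * crossing (swap i.+1 p) (swap i.+1 q) (swap i.+1 r) i *
    crossing (swap i (swap i.+1 p)) (swap i (swap i.+1 q)) (swap i (swap i.+1 r)) i.+1.
Proof.
have e01 : (i == i.+1) = false by lia.
have e02 : (i == i.+2) = false by lia.
have e12 : (i.+1 == i.+2) = false by lia.
have e10 : (i.+1 == i) = false by lia.
have e20 : (i.+2 == i) = false by lia.
have e21 : (i.+2 == i.+1) = false by lia.
have l10 : (i.+1 < i) = false by lia.
have l20 : (i.+2 < i) = false by lia.
have l21 : (i.+2 < i.+1) = false by lia.
have E := (eqxx, e01, e02, e12, e10, e20, e21, l10, l20, l21, ltnn, ltnSn i).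
have swaps : ((swap i i = i.+1) * (swap i i.+1 = i) * (swap i i.+2 = i.+2) *
  (swap i.+1 i = i) * (swap i.+1 i.+1 = i.+2) * (swap i.+1 i.+2 = i.+1))%type.
  by rewrite /swap !E.
case: (windowP i p) => [|||po]; case: (windowP i q) => [|||qo]; rewrite ?eqxx // => _;
case: (windowP i r) => [|||ro]; rewrite ?eqxx // => _ _.
(* Each of po, qo, ro exists only in the branches where that strand is outside
   the window, hence the optional rewriting. *)
all: rewrite ?swaps ?po ?qo ?ro ?swaps /crossing ?E ?po ?qo ?ro ?E /=.
all: by rewrite ?(mulg1, mul1g) ?mulgA ?(mulgV, mulVg, mulgK, mulgVK) ?(mulg1, mul1g).
Qed.

Lemma crossing_swap_far p q r i j : i.+1 < j \/ j.+1 < i ->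
  crossing (swap j p) (swap j q) (swap j r) i = crossing p q r i.
Proof.
move=> ij.
have eq0 u : (swap j u == i) = (u == i) by rewrite /swap; do !case: eqP; lia.
have eq1 u : (swap j u == i.+1) = (u == i.+1).
  by rewrite /swap; do !case: eqP; lia.
have lt u : (swap j u < i) = (u < i) by rewrite /swap; do !case: eqP; lia.
by rewrite /crossing !eq0 !eq1 lt.
Qed.

(** At most one of two distant crossings involves two of the three strands, and
    the other crossing does not change its value. *)
Lemma crossing_far p q r i j : i.+1 < j ->
  crossing p q r i * crossing (swap i p) (swap i q) (swap i r) j =
  crossing p q r j * crossing (swap j p) (swap j q) (swap j r) i.
Proof.
move=> ij; rewrite !crossing_swap_far; [|by left|by right].
have [->|->] : crossing p q r i = 1 \/ crossing p q r j = 1.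
- rewrite /crossing; repeat (case: ifP => ?; try by [left|right]); exfalso; lia.
- by rewrite mulg1 mul1g.
- by rewrite mulg1 mul1g.
Qed.

Section Words.

Variables (n : nat) (a b c : 'I_n).
Hypothesis abc : uniq [:: a; b; c].

Let s_ := @adjacent_transposition n.

Definition perm_crossing (s : 'S_n) (i : 'I_n.-1) : K :=
  crossing (s a) (s b) (s c) i.

(** The state [s] sends each strand to its current position.  An inverse letter
    undoes the crossing made from the state that it leads to. *)
Fixpoint track (s : 'S_n) (w : word 'I_n.-1) : K :=
  if w is (i, e) :: w' then
    (if e then (perm_crossing (s * s_ i) i)^-1 else perm_crossing s i) *
    track (s * s_ i) w'
  else 1.

Lemma track_cat s u v :
  track s (u ++ v) = track s u * track (s * eval_word s_ u) v.
Proof.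
elim: u s => [|[i e] u IHu] s /=; first by rewrite mul1g /eval_word big_nil mulg1.
rewrite IHu mulgA /eval_word big_cons /= mulgA.
by have -> : (if e then (s_ i)^-1 else s_ i) = s_ i by case: e; rewrite ?tpermV.
Qed.

Lemma perm_crossingM s i j : perm_crossing (s * s_ i) j =
  crossing (swap i (s a)) (swap i (s b)) (swap i (s c)) j.
Proof. by rewrite /perm_crossing !permM !adjacent_transpositionE. Qed.

Lemma track_braid_rel s u v : braid_rel u v -> track s u = track s v.
Proof.
have inj := inj_eq (@perm_inj _ s).
case=> i j ij; rewrite /= !mulg1 ?mulgA !perm_crossingM /perm_crossing
  ?permM ?adjacent_transpositionE.
  rewrite ij; apply: crossing_braid; rewrite val_eqE inj;
  by move: abc; rewrite /= !inE negb_or => /and3P[/andP[]].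
case/orP: ij => ij; last exact: crossing_far.
by symmetry; apply: crossing_far.
Qed.

Lemma track_word_eq s u v : word_eq (@braid_rel n) u v -> track s u = track s v.
Proof.
move=> uv; elim: uv s => {u v}.
- by move=> u v /track_braid_rel uv s.
- move=> i e s; have ss : s * s_ i * s_ i = s by rewrite -mulgA tperm2 mulg1.
  by rewrite /= ss mulg1; case: e; rewrite /= ?mulgV ?mulVg.
- move=> u u' v v' uu' IHu vv' IHv s; rewrite !track_cat IHu IHv.
  by rewrite (eval_word_eq (@adjacent_transposition_braid_rel n) uu').
- by [].
- by move=> u v _ IH s.
- by move=> v u w _ IHv _ IHw s; rewrite IHv.
Qed.

(** The proof of distinctness is an argument so that the homomorphism structure
    can be inferred from the function. *)
Definition pure_track (_ : uniq [:: a; b; c]) (x : pure_braid_group n) : K :=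
  track 1 (repr (val x)).

Fact pure_track_morphism : monoid.monoid_morphism (pure_track abc).
Proof.
split=> [|g h]; rewrite /pure_track.
  by rewrite val1 (track_word_eq _ (word_eq_repr _ [::])).
rewrite valM (track_word_eq _ (word_eq_repr _ (repr (val g) ++ repr (val h)))).
rewrite track_cat mul1g; congr (_ * track _ _).
by have /eqP := valP g.
Qed.

HB.instance Definition _ :=
  isUMagmaMorphism.Build _ _ (pure_track abc) pure_track_morphism.

End Words.
End Cocycle.

Lemma pure_word n (i : 'I_n.-1) : exists g : pure_braid_group n,
  word_eq (@braid_rel n) (repr (val g)) (gen_word [:: i; i]).
Proof.
have /pureP gP := @pure_sq n i.
exists (Sub (sigma n i ^+ 2) gP); apply/class_ofP; rewrite class_of_repr SubK.
by rewrite class_of_gen_word expg2 sigmaE !big_cons big_nil mulg1.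
Qed.

(** Tracking the strands 0, 1, 2, the square of sigma_0 goes to the first free
    generator and the square of sigma_1 to the second. *)
Lemma free2_epimorphic n : 3 <= n ->
  epimorphic_image (pure_braid_group n) (free_group 2).
Proof.
move=> n3.
pose x : free_group 2 := presented_gen _ (@Ordinal 2 0 isT).
pose y : free_group 2 := presented_gen _ (@Ordinal 2 1 isT).
pose o i (lt_i : i < 3) : 'I_n := Ordinal (leq_trans lt_i n3).
pose o0 := o 0%N isT; pose o1 := o 1%N isT; pose o2 := o 2 isT.
have abc : uniq [:: o0; o1; o2] by [].
pose f : group_hom _ _ := pure_track x y abc.
exists f.
have n1 : 0 < n.-1 by lia.
have n2 : 1%N < n.-1 by lia.
have fx : exists g, f g = x.
  have [g gE] := pure_word (Ordinal n1); exists g.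
  rewrite /f /= /pure_track (track_word_eq x y abc _ gE) /= !perm_crossingM.
  by rewrite /perm_crossing !perm1 /crossing /swap /= mul1g mulg1.
have fy : exists g, f g = y.
  have [g gE] := pure_word (Ordinal n2); exists g.
  rewrite /f /= /pure_track (track_word_eq x y abc _ gE) /= !perm_crossingM.
  by rewrite /perm_crossing !perm1 /crossing /swap /= mul1g mulg1.
have gen i : exists g, f g = presented_gen _ i.
  by case: i => [[|[|//]] lt_i]; [case: fx => g gx|case: fy => g gx]; exists g;
    rewrite gx; congr presented_gen; apply: val_inj.
elim/presented_ind => [|_ _ [g <-] [h <-]|//|i].
- by exists 1; rewrite gmulf1.
- by exists (g * h); rewrite gmulfM.
- by have [g <-] := gen i; exists g^-1; rewrite gmulfV.
Qed.

Theorem corollary3p7 (n : nat) (hn : 3 <= n) : has_corank (pure_braid_group n) 2.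
Proof.
by split=> [|m]; [exact: free2_epimorphic | exact: corank_le2].
Qed.
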